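(* Let $X=X_{r_1}\cup\cdots\cup X_{r_\ell}$, where $0<r_1<\cdots<r_\ell\le n$, in $\mathcal{H}(n,2)$, and let $\ell'=\ell$ if $r_\ell<n$ and $\ell'=\ell-1$ if $r_\ell=n$. Suppose $X\neq X_n$. Then $X$ has fractional revival if and only if $$\min\Big\{j+\alpha_2\Big(\sum_{i=1}^{\ell'}\binom{n-j-1}{r_i-j}\Big):j=1,\ldots,r_{\ell'}\Big\}\ \ge\ \min\Big\{j+\alpha_2\Big(\sum_{i=1}^{\ell}\binom{n-j}{r_i-j}\Big):j=1,\ldots,r_\ell\Big\}.$$ Moreover, if equality holds, then $X$ has perfect state transfer but no other form of fractional revival, and if strict inequality holds, then $X$ has perfect state transfer as well as balanced fractional revival.
   Context: The graph $X_r$ in the binary Hamming scheme $\mathcal{H}(n,2)$ has as vertices the binary sequences of length $n$, two being adjacent iff their Hamming distance is exactly $r$; the union $X_{r_1}\cup\cdots\cup X_{r_\ell}$ has adjacency matrix $A=A(X_{r_1})+\cdots+A(X_{r_\ell})$. With $U(t)=e^{-\mathrm{i}tA}$, fractional revival (from $a$ to $b\neq a$ at time $\tau>0$) means $U(\tau)\mathbf{e}_a=\alpha\mathbf{e}_a+\beta\mathbf{e}_b$ for complex $\alpha,\beta$ with $\beta\ne0$, $|\alpha|^2+|\beta|^2=1$; it is perfect state transfer if $\alpha=0$ and balanced if $|\alpha|=|\beta|=1/\sqrt2$. $X$ has one of these properties if it occurs for some $a,b,\tau$. For a positive integer $m$, $\alpha_2(m)$ is the largest $k$ such that $2^k$ divides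 $m$. Convention: $\binom{a}{b}=0$ if $b<0$ or $b>a$. *)

(* Defs.v *)
From HB Require Import structures.
From mathcomp Require Import all_boot all_order all_algebra.
From mathcomp Require Export complex.
From mathcomp Require Import all_classical all_reals all_analysis.

Set Implicit Arguments.
Unset Strict Implicit.
Unset Printing Implicit Defensive.

Import Order.TTheory GRing.Theory Num.Theory.
Import numFieldNormedType.Exports.
Local Open Scope ring_scope.
Local Open Scope complex_scope.

(* The limit is taken in the product (entrywise) topology on matrices. *)
Definition expmx (K : numFieldType) (m : nat) (A : 'M[K]_m) : 'M[K]_m :=
  limn (series (fun k : nat => (k`!%:R)^-1 *: A ^+ k)).

(* A graph on the finite type V is given by its adjacency relation; rows and
   columns are indexed through the enumeration of V. *)
Definition adjmx (K : numFieldType) (V : finType) (e : rel V) : 'M[K]_#|V| :=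
  \matrix_(i, j) (e (enum_val i) (enum_val j))%:R.

Definition vertexv (K : numFieldType) (V : finType) (a : V) : 'cV[K]_#|V| :=
  delta_mx (enum_rank a) 0.

Definition walkmx (R : realType) (V : finType) (e : rel V) (t : R)
    : 'M[R[i]]_#|V| :=
  expmx ((- ('i * t%:C)) *: adjmx R[i] e).

Definition revival_at (R : realType) (V : finType) (e : rel V)
    (a b : V) (tau : R) (alpha beta : R[i]) : Prop :=
  [/\ a != b, 0 < tau,
      walkmx e tau *m vertexv R[i] a
        = alpha *: vertexv R[i] a + beta *: vertexv R[i] b,
      beta != 0 & `|alpha| ^+ 2 + `|beta| ^+ 2 = 1].

Definition fractional_revival (R : realType) (V : finType) (e : rel V) : Prop :=
  exists (a b : V) (tau : R) (alpha beta : R[i]),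
    revival_at e a b tau alpha beta.

Definition perfect_state_transfer (R : realType) (V : finType) (e : rel V)
    : Prop :=
  exists (a b : V) (tau : R) (alpha beta : R[i]),
    revival_at e a b tau alpha beta /\ alpha = 0.

Definition balanced_revival (R : realType) (V : finType) (e : rel V) : Prop :=
  exists (a b : V) (tau : R) (alpha beta : R[i]),
    [/\ revival_at e a b tau alpha beta,
        `|alpha| = (sqrtC 2)^-1 & `|beta| = (sqrtC 2)^-1].

Definition only_perfect_revival (R : realType) (V : finType) (e : rel V)
    : Prop :=
  forall (a b : V) (tau : R) (alpha beta : R[i]),
    revival_at e a b tau alpha beta -> alpha = 0.

Definition hdist (n : nat) (u v : n.-tuple bool) : nat :=
  #|[set k : 'I_n | tnth u k != tnth v k]|.

Definition hamming_graph (n r : nat) : rel (n.-tuple bool) :=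
  fun u v => hdist u v == r.

(* The union of X_(r 1), ..., X_(r l); the values of r outside [1, l] are
   irrelevant. *)
Definition hamming_union (n l : nat) (r : nat -> nat) : rel (n.-tuple bool) :=
  fun u v => has (fun i => hamming_graph (r i) u v) (iota 1 l).

(* For r injective on [1, l], the edge sets are disjoint and the adjacency
   matrix of the union is the sum of the adjacency matrices. *)
Lemma adjmx_hamming_union (K : numFieldType) (n l : nat) (r : nat -> nat) :
  {in iota 1 l &, injective r} ->
  adjmx K (@hamming_union n l r)
    = \sum_(1 <= i < l.+1) adjmx K (@hamming_graph n (r i)).
Proof.
move=> rI; apply/matrixP => p q; rewrite summxE !mxE.
under eq_bigr do rewrite mxE.
set u := enum_val p; set v := enum_val q.
rewrite /hamming_union /hamming_graph /index_iota subn1 /=.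
elim: (iota 1 l) (iota_uniq 1 l) rI => [|i s IHs] /=; first by rewrite big_nil.
move=> /andP[isN us] rI; rewrite big_cons -IHs //; last first.
  by move=> x y xs ys; apply: rI; rewrite inE ?xs ?ys orbT.
case: eqP => [ui|_]; last by rewrite add0r.
rewrite -[has _ s]negbK -all_predC; case: allP => [_|[]]; first by rewrite addr0.
move=> j js /=; apply: contraNN isN; rewrite ui => /eqP /rI.
by rewrite !inE eqxx js orbT => ->.
Qed.

(* Binomial coefficient with an integer lower index, zero when it is
   negative. *)
Definition binz (a : nat) (b : int) : nat := if b is Posz k then 'C(a, k) else 0.

(* min {F j : 1 <= j <= m}, for m >= 1 (F 1 is then one of the terms). *)
Definition minseq (m : nat) (F : nat -> nat) : nat :=
  \big[minn/F 1%N]_(1 <= j < m.+1) F j.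

Definition alpha2 (m : nat) : nat := logn 2 m.

(* The number l' of indices i with r i < n. *)
Definition num_proper (n l : nat) (r : nat -> nat) : nat :=
  if r l == n then l.-1 else l.

(* Here j <= r l' < n, so the natural subtraction n - j - 1 does not
   truncate. *)
Definition lower_min (n l : nat) (r : nat -> nat) : nat :=
  let l' := num_proper n l r in
  minseq (r l') (fun j =>
    j + alpha2 (\sum_(1 <= i < l'.+1) binz (n - j - 1) ((r i)%:Z - j%:Z)))%N.

Definition full_min (n l : nat) (r : nat -> nat) : nat :=
  minseq (r l) (fun j =>
    j + alpha2 (\sum_(1 <= i < l.+1) binz (n - j) ((r i)%:Z - j%:Z)))%N.

(* Main.v *)
Require Import Defs.
From mathcomp Require Import all_boot all_order all_algebra.
From mathcomp Require Import all_classical all_reals all_analysis.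
From mathcomp Require Import ring lra.

(** The characters [chi u] of the hypercube diagonalize the adjacency matrix,
    the eigenvalue of [chi u] depending only on the weight [s] of [u]: it is
    the sum over [i] of the coefficients of ['X^(r i)] in
    [(1 - 'X)^s (1 + 'X)^(n - s)].  Comparing coefficients along the characters
    of weight at most one shows that revival takes place between antipodal
    vertices only, and that at time [2 pi x] it amounts to
    [exp (- 2 pi i x lam_s)] being a nonconstant function of the parity of [s].
    Hence [x (lam_s - lam_(s+2))] must always be an integer, but not
    [x (lam_s - lam_(s+1))].  As [lam_s - lam_(s+1)] comes from
    [(1 - 'X)^s (1 + 'X)^(n-1-s) 2'X], and these polynomials span the same
    lattice as the [(2'X)^j (1 + 'X)^(n-j)], the conditions become
    [x 2^(lower+1)] integral and [x 2^full] not integral.  The times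
    [x = 2^-(full+1)] and [x = 2^-(full+2)] give perfect and balanced revival. *)

Set Implicit Arguments.
Unset Strict Implicit.
Unset Printing Implicit Defensive.

Import Order.TTheory GRing.Theory Num.Theory.
Import numFieldNormedType.Exports.
Local Open Scope ring_scope.
Local Open Scope complex_scope.

(** * Exponential series of imaginary numbers; entrywise limits of matrices *)

Section ComplexLimits.
Local Open Scope classical_set_scope.
Variable R : realType.
Local Notation C := (R[i] : numFieldType).

Lemma normc_real_complex (x : R) : `|x%:C| = `|x|%:C.
Proof. by rewrite normc_def /= expr0n addr0 sqrtr_sqr. Qed.

Lemma cvg_real_complex (u : R^nat) (l : R) :
  u @ \oo --> l -> (fun n => (u n)%:C : C) @ \oo --> (l%:C : C).
Proof.
move=> ul; apply/cvgrPdist_lt => e e_gt0.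
have [eE re_gt0] : e = (complex.Re e)%:C /\ 0 < complex.Re e.
  by case: e e_gt0 => a b; rewrite ltcE /= => /andP[/eqP -> ->].
move/cvgrPdist_lt : ul => /(_ _ re_gt0); apply: filterS => n.
by rewrite eE -rmorphB normc_real_complex ltcR.
Qed.

Definition cis (x : R) : R[i] := (cos x)%:C + 'i * (sin x)%:C.

Lemma exp_term_cos_sin (x : R) (k : nat) :
  (k`!%:R)^-1 * ('i * x%:C) ^+ k
    = (cos_coeff x k)%:C + 'i * (sin_coeff x k)%:C :> R[i].
Proof.
rewrite /cos_coeff /sin_coeff /= exprMn.
(* This mirrors the shape of [cos_coeff] and [sin_coeff]: a parity indicator times a power of -1, so
   that [ring] can conclude. *)
have -> : 'i ^+ k = (odd k)%:R * 'i * (-1) ^+ k.-1./2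
    + (~~ odd k)%:R * (-1) ^+ k./2 :> R[i].
  rewrite -[in LHS](odd_double_half k) exprD -mul2n exprM sqrCi.
  case: (boolP (odd k)) => ok /=; rewrite ?expr1 ?expr0 !(mul1r, mul0r, addr0, add0r) //.
  suff -> : k.-1./2 = k./2 by [].
  by case: k ok => //= k; rewrite uphalf_half => /negPf ->.
rewrite !(rmorphM, rmorphXn, rmorphN, rmorph_nat, rmorph1, fmorphV) /=.
by ring.
Qed.

(** The equation for [z] is a premise so that the lemma applies to an eigenvalue in whatever form it
    takes. *)
Lemma cvg_cis (x : R) (z : C) : z = 'i * x%:C ->
  series (fun k => (k`!%:R)^-1 * z ^+ k) @ \oo --> (cis x : C).
Proof.
move=> ->.
have -> : series (fun k => (k`!%:R)^-1 * ('i * x%:C) ^+ k : C) =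
    (fun n => (series (cos_coeff x) n)%:C + 'i * (series (sin_coeff x) n)%:C)
    :> C^nat.
  apply/funext => n; rewrite /series /= !rmorph_sum mulr_sumr -big_split /=.
  by apply: eq_bigr => k _; exact: exp_term_cos_sin.
apply: cvgD.
  by apply: cvg_real_complex; rewrite unlock; exact: is_cvg_series_cos_coeff.
apply: cvgM; first exact: cvg_cst.
by apply: cvg_real_complex; rewrite unlock; exact: is_cvg_series_sin_coeff.
Qed.

Lemma cvg_mx (K : numFieldType) m p (u : nat -> 'M[K]_(m, p)) (M : 'M[K]_(m, p)) :
  (forall i j, (fun n => u n i j) @ \oo --> M i j) -> u @ \oo --> M.
Proof.
move=> uM A [P nP PA].
have : \forall n \near \oo, forall ij : 'I_m * 'I_p, P ij.1 ij.2 (u n ij.1 ij.2).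
  by apply: filter_forall => -[i j]; exact: (uM i j).
by apply: filterS => n Pn; apply: PA => i j; exact: (Pn (i, j)).
Qed.

Lemma expmx_lim (K : numFieldType) m (A M : 'M[K]_m) :
  (forall i j, (series (fun k => (k`!%:R)^-1 * (A ^+ k) i j) @ \oo) --> M i j) ->
  expmx A = M.
Proof.
move=> AM; rewrite /expmx; apply/cvg_lim.
  exact: norm_hausdorff.
apply: cvg_mx => i j.
rewrite (_ : (fun n => _) = series (fun k => (k`!%:R)^-1 * (A ^+ k) i j)); first exact: AM.
by apply/funext => n; rewrite /series /= summxE; apply: eq_bigr => k _; rewrite mxE.
Qed.
End ComplexLimits.

(** * Characters of the hypercube and Krawtchouk polynomials *)

Section Characters.
Variable n : nat.
Implicit Types u v w a : n.-tuple bool.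

Definition weight u : nat := #|[set k | tnth u k]|.

(** Distributivity; read from right to left, it factors a sum over all vertices into one factor per
    coordinate. *)
Lemma prod_sum_tuple (S : comNzRingType) (F : 'I_n -> bool -> S) :
  \prod_(k < n) (F k true + F k false)
    = \sum_(u : n.-tuple bool) \prod_(k < n) F k (tnth u k).
Proof.
under eq_bigr do rewrite -big_bool.
rewrite bigA_distr_bigA /= (reindex (fun u => [ffun k => tnth u k])) /=.
  by apply: eq_bigr => u _; apply: eq_bigr => k _; rewrite ffunE.
exists (fun f : {ffun 'I_n -> bool} => [tuple f k | k < n]) => [u _|f _].
  by apply: eq_from_tnth => k; rewrite tnth_mktuple ffunE.
by apply/ffunP => k; rewrite ffunE tnth_mktuple.
Qed.

Definition chi (S : nzRingType) u v : S :=
  \prod_(k < n) (-1) ^+ (tnth u k && tnth v k).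

Lemma chiC (S : nzRingType) u v : chi S u v = chi S v u.
Proof. by apply: eq_bigr => k _; rewrite andbC. Qed.

Lemma chi_mul_self (S : comNzRingType) u v : chi S u v * chi S u v = 1.
Proof.
rewrite -big_split big1 // => k _ /=.
by case: (_ && _); rewrite ?mulrNN ?mulr1.
Qed.

(** The sum factors over coordinates, with factor 2 where [u] and [v] agree and 0 where they
    differ. *)
Lemma chi_orth (S : comNzRingType) u v :
  \sum_w chi S u w * chi S v w = (u == v)%:R * 2 ^+ n.
Proof.
transitivity (\prod_(k < n) (((-1) ^+ (tnth u k) * (-1) ^+ (tnth v k) : S) + 1)).
  pose F (k : 'I_n) (b : bool) : S :=
    (-1) ^+ (tnth u k && b) * (-1) ^+ (tnth v k && b).
  rewrite (eq_bigr (fun w => \prod_(k < n) F k (tnth w k))) => [|w _].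
    rewrite -(prod_sum_tuple F); apply: eq_bigr => k _.
    by rewrite /F !andbT !andbF mulr1.
  by rewrite -big_split.
case: eqVneq => [->|neq_uv].
  rewrite mul1r (eq_bigr (fun=> 2)) ?prodr_const ?card_ord // => k _.
  by rewrite -signr_addb addbb.
have [k neq_k] : exists k, tnth u k != tnth v k.
  apply/existsP; apply: contraNT neq_uv; rewrite negb_exists => /forallP eq_uv.
  by apply/eqP/eq_from_tnth => k; apply/eqP; rewrite -[_ == _]negbK.
rewrite (bigD1 k) //= mul0r; move: neq_k.
by case: (tnth u k) (tnth v k) => -[] //= _; rewrite ?mulr1 ?mul1r addNr mul0r.
Qed.

(* The generating function of the values at [s] of the Krawtchouk polynomials. *)
Definition krawpoly (S : nzRingType) (m s : nat) : {poly S} :=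
  (1 - 'X) ^+ s * (1 + 'X) ^+ (m - s).

Lemma map_krawpoly (S : nzRingType) m s :
  map_poly (intr : int -> S) (krawpoly int m s) = krawpoly S m s.
Proof.
by rewrite rmorphM !rmorphXn rmorphB rmorphD /= map_polyX rmorph1.
Qed.

Lemma prod_weight (S : comNzRingType) (x y : S) u :
  \prod_(k < n) (if tnth u k then x else y) = x ^+ weight u * y ^+ (n - weight u).
Proof.
rewrite (bigID (tnth u)) /=; congr (_ * _).
  rewrite (eq_bigr (fun=> x)) => [|k ->] //.
  by rewrite prodr_const /weight cardsE.
rewrite (eq_bigr (fun=> y)) => [|k /negPf ->] //.
rewrite prodr_const; congr (_ ^+ _).
rewrite -[n in (n - _)%N]card_ord -(cardC [pred k | tnth u k]).
rewrite /weight cardsE addKn.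
by apply: eq_card => k; rewrite !inE.
Qed.

Lemma hdistE a v : hdist a v = (\sum_(k < n) (tnth a k != tnth v k))%N.
Proof. by rewrite /hdist -sum1dep_card big_mkcond; apply: eq_bigr => k _; case: ifP. Qed.

(** The sum factors over coordinates. Up to the sign that goes into [chi S u a], coordinate [k]
    contributes [1 - 'X] if [u] is set there and [1 + 'X] otherwise. All distances are treated at
    once; [sum_hamming_chi] extracts a single one. *)
Lemma sum_Xhdist_chi (S : comNzRingType) a u :
  \sum_v chi S u v *: 'X ^+ hdist a v = chi S u a *: krawpoly S n (weight u).
Proof.
pose F (k : 'I_n) b : {poly S} := (-1) ^+ (tnth u k && b) *: 'X ^+ (tnth a k != b).
rewrite (eq_bigr (fun v => \prod_(k < n) F k (tnth v k))) => [|v _]; last first.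
  by rewrite scaler_prod hdistE expr_sum.
rewrite -(prod_sum_tuple F) /krawpoly -prod_weight -scaler_prod; apply: eq_bigr => k _.
rewrite /F; case: (tnth u k) (tnth a k) => -[] /=;
  rewrite ?expr0 ?expr1 ?scale1r ?scaleN1r ?opprB ?opprD //.
all: by rewrite ?[_ + 1]addrC // addrC.
Qed.

Lemma sum_hamming_chi (S : comNzRingType) r a u :
  \sum_v (hamming_graph r a v)%:R * chi S u v
    = ((krawpoly int n (weight u))`_r)%:~R * chi S u a.
Proof.
have /(congr1 (fun p : {poly S} => p`_r)) := sum_Xhdist_chi S a u.
rewrite coef_sum coefZ -map_krawpoly coef_map [RHS]mulrC => <-.
by apply: eq_bigr => v _; rewrite coefZ coefXn mulrC eq_sym.
Qed.

End Characters.

(** * Spectral decomposition of the adjacency matrix and of the walk *)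

Lemma exprZ_mx (S : comNzRingType) m (c : S) (M : 'M[S]_m) k :
  (c *: M) ^+ k = c ^+ k *: M ^+ k.
Proof.
elim: k => [|k IHk]; first by rewrite !expr0 scale1r.
rewrite !exprS IHk -[LHS]/((c *: M) *m (c ^+ k *: M ^+ k)).
by rewrite -scalemxAl -scalemxAr scalerA.
Qed.

Section Spectrum.
Variables (K : numFieldType) (n l : nat) (r : nat -> nat).
Hypothesis r_inj : {in iota 1 l &, injective r}.
Local Notation V := (n.-tuple bool).
Local Notation A := (adjmx K (@hamming_union n l r)).

Definition eigval (s : nat) : int := \sum_(1 <= i < l.+1) (krawpoly int n s)`_(r i).

(** The orthogonal projection onto the line of the character [u], whose squared norm is [2 ^+ n]. *)
Definition charproj (u : V) : 'M[K]_#|{: V}| :=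
  \matrix_(i, j) ((2 ^+ n)^-1 * (chi K u (enum_val i) * chi K u (enum_val j))).

Lemma sum_enum_val (F : V -> K) : \sum_(i < #|{: V}|) F (enum_val i) = \sum_v F v.
Proof.
rewrite [RHS](reindex (@enum_val V predT)) //=.
by exists enum_rank => ? _; rewrite (enum_valK, enum_rankK).
Qed.

Lemma adjmx_mul_idem u : A *m charproj u = (eigval (weight u))%:~R *: charproj u.
Proof.
apply/matrixP => i j; rewrite adjmx_hamming_union // !mxE.
under eq_bigr do rewrite summxE !mxE.
set a := enum_val i; set b := enum_val j.
transitivity (\sum_v (2 ^+ n)^-1 * chi K u b *
   (\sum_(1 <= k < l.+1) (hamming_graph (r k) a v)%:R * chi K u v)).
  rewrite -sum_enum_val; apply: eq_bigr => k _.
  rewrite mulr_suml mulr_sumr; apply: eq_bigr => m _.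
  by rewrite mxE; ring.
rewrite -mulr_sumr exchange_big /=.
under eq_bigr do rewrite sum_hamming_chi.
by rewrite -mulr_suml -rmorph_sum /= -/(eigval _); ring.
Qed.

Lemma sum_idem : \sum_u charproj u = 1%:M.
Proof.
apply/matrixP => i j; rewrite summxE !mxE.
under eq_bigr do rewrite mxE (chiC _ _ (enum_val i)) (chiC _ _ (enum_val j)).
rewrite -mulr_sumr chi_orth mulrCA mulVf ?mulr1 ?expf_neq0 ?pnatr_eq0 //.
by rewrite (inj_eq enum_val_inj).
Qed.

Lemma adjmx_exp k : A ^+ k = \sum_u (eigval (weight u))%:~R ^+ k *: charproj u.
Proof.
elim: k => [|k IHk].
  by rewrite expr0 -[1]/(1%:M) -sum_idem; apply: eq_bigr => u _; rewrite scale1r.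
rewrite exprS IHk -[_ * _]/(_ *m _) mulmx_sumr; apply: eq_bigr => u _.
by rewrite -scalemxAr adjmx_mul_idem scalerA exprSr.
Qed.

(** Powers of the adjacency matrix are combinations of fixed projections, so the matrix series
    reduces to a finite sum of scalar series. Their limits are a premise, as [K] need not be
    complete. *)
Lemma expmx_adjmx (c : K) (e : V -> K) :
  (forall u, (series (fun k => (k`!%:R)^-1 * (c * (eigval (weight u))%:~R) ^+ k)
                @ \oo --> e u)%classic) ->
  expmx (c *: A) = \sum_u e u *: charproj u.
Proof.
move=> ce; apply: expmx_lim => i j; rewrite summxE.
have -> : series (fun k => (k`!%:R)^-1 * ((c *: A) ^+ k) i j) =
    (fun m => \sum_u
       series (fun k => (k`!%:R)^-1 * (c * (eigval (weight u))%:~R) ^+ k) m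
                * charproj u i j).
  apply/funext => m; rewrite /series /=.
  under [RHS]eq_bigr do rewrite mulr_suml.
  rewrite exchange_big /=; apply: eq_bigr => k _.
  rewrite exprZ_mx adjmx_exp scaler_sumr summxE mulr_sumr; apply: eq_bigr => u _.
  by rewrite !mxE exprMn; ring.
apply: cvg_big => [|u _]; first exact: add_continuous.
have -> : (e u *: charproj u) i j = e u * charproj u i j by rewrite mxE.
by apply: cvgM; [exact: ce|exact: cvg_cst].
Qed.

End Spectrum.

Lemma walkmxE (R : realType) (n l : nat) (r : nat -> nat) (t : R) :
  {in iota 1 l &, injective r} ->
  walkmx (@hamming_union n l r) t
    = \sum_(u : n.-tuple bool)
        cis (- (t * (eigval n l r (weight u))%:~R)) *: charproj R[i] u.
Proof.
move=> r_inj; apply: (expmx_adjmx r_inj) => u.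
apply: cvg_cis.
by rewrite rmorphN rmorphM /= rmorph_int mulrN mulNr mulrA.
Qed.

(** * The revival equation in the basis of characters *)

Section Revival.
Variables (K : numFieldType) (n : nat).
Local Notation V := (n.-tuple bool).
Implicit Types u v a : V.

Definition chirow u : 'rV[K]_#|{: V}| := \row_j chi K u (enum_val j).

Lemma charprojE u : charproj K u = (2 ^+ n)^-1 *: ((chirow u)^T *m chirow u).
Proof. by apply/matrixP => i j; rewrite !mxE big_ord1 !mxE. Qed.

Lemma chirow_charproj v u :
  chirow v *m charproj K u = (v == u)%:R *: chirow u.
Proof.
apply/rowP => j; rewrite !mxE.
transitivity (\sum_w (2 ^+ n)^-1 * chi K u (enum_val j) * (chi K v w * chi K u w)).
  by rewrite -sum_enum_val; apply: eq_bigr => k _; rewrite !mxE; ring.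
by rewrite -mulr_sumr chi_orth; field; rewrite expf_neq0 ?pnatr_eq0.
Qed.

Lemma chirow_vertexv v a : chirow v *m vertexv K a = (chi K v a)%:M.
Proof.
by rewrite /vertexv -colE; apply/matrixP => i j; rewrite !ord1 !mxE enum_rankK.
Qed.

(** The projections sum to the identity and each factors through its row, so the characters separate
    vectors. *)
Lemma chirow_inj (x y : 'cV[K]_#|{: V}|) :
  (forall v, chirow v *m x = chirow v *m y) -> x = y.
Proof.
move=> xy; rewrite -[x]mul1mx -[y]mul1mx -(sum_idem K n) !mulmx_suml.
by apply: eq_bigr => u _; rewrite charprojE -!scalemxAl -!mulmxA xy.
Qed.

Lemma spectral_vertexv (c : V -> K) a b (alpha beta : K) :
  (\sum_u c u *: charproj K u) *m vertexv K a
    = alpha *: vertexv K a + beta *: vertexv K b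
  <-> forall u, c u * chi K u a = alpha * chi K u a + beta * chi K u b.
Proof.
have lhs u : chirow u *m ((\sum_u c u *: charproj K u) *m vertexv K a)
    = (c u * chi K u a)%:M.
  rewrite mulmxA mulmx_sumr (bigD1 u) //= big1 => [|v neq_vu].
    rewrite addr0 -scalemxAr chirow_charproj eqxx scale1r -scalemxAl.
    by rewrite chirow_vertexv scale_scalar_mx.
  by rewrite -scalemxAr chirow_charproj eq_sym (negPf neq_vu) scale0r scaler0.
have rhs u : chirow u *m (alpha *: vertexv K a + beta *: vertexv K b)
    = (alpha * chi K u a + beta * chi K u b)%:M.
  by rewrite mulmxDr -!scalemxAr !chirow_vertexv !scale_scalar_mx raddfD.
split=> [eq_ab u|eq_c]; last by apply: chirow_inj => u; rewrite lhs rhs eq_c.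
move/(congr1 (mulmx (chirow u))): eq_ab; rewrite lhs rhs => /matrixP/(_ 0 0).
by rewrite !mxE.
Qed.

End Revival.

(** * Comparing a character at two vertices *)

Section Antipode.
Variable n : nat.
Local Notation V := (n.-tuple bool).

(** A representative of each weight; the cases [0] and [n] also serve as the antipodal pair that
    exhibits revival. *)
Definition initial_ones (s : nat) : V := [tuple (k < s)%N | k < n].

Lemma weight_initial_ones s : (s <= n)%N -> weight (initial_ones s) = s.
Proof.
move=> le_sn; have widen_inj : injective (widen_ord le_sn).
  by move=> i j /(congr1 val) /= /val_inj.
rewrite /weight -[RHS]card_ord -(card_imset _ widen_inj).
apply: eq_card => k; rewrite inE tnth_mktuple; apply/idP/imsetP => [lt_ks|[j _ ->]].
  by exists (Ordinal lt_ks) => //; apply: val_inj.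
exact: (ltn_ord j).
Qed.

Lemma weight_le (u : V) : (weight u <= n)%N.
Proof. by rewrite -[n in (_ <= n)%N]card_ord max_card. Qed.

Lemma chi_ratio (S : comNzRingType) (u a b : V) :
  chi S u b = chi S u a * \prod_(k < n) (-1) ^+ (tnth u k && (tnth a k != tnth b k)).
Proof.
rewrite -big_split; apply: eq_bigr => k _ /=.
by case: (tnth u k) (tnth a k) (tnth b k) => -[] [] //=; rewrite ?mulr1 ?mulrNN ?mulr1 ?mul1r.
Qed.

Lemma chi_antipode (S : comNzRingType) (u a b : V) :
  (forall k, tnth a k != tnth b k) -> chi S u b = chi S u a * (-1) ^+ weight u.
Proof.
move=> ab; rewrite (chi_ratio S u a b); congr (_ * _).
have := prod_weight (-1) (1 : S) u; rewrite expr1n mulr1 => <-.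
by apply: eq_bigr => k _; rewrite ab andbT; case: (tnth u k).
Qed.

(** A character of weight one tests a single coordinate, while its eigenvalue does not depend on
    which one. *)
Lemma chi_singleton (S : comNzRingType) (a b : V) (k : 'I_n) :
  exists u, weight u = 1%N /\
    chi S u b = chi S u a * (-1) ^+ (tnth a k != tnth b k).
Proof.
exists [tuple j == k | j < n]; split.
  rewrite /weight -(cards1 k); apply: eq_card => j.
  by rewrite !inE tnth_mktuple.
rewrite (chi_ratio S _ a b) (bigD1 k) //= big1 ?mulr1 => [|j neq_jk].
  by rewrite tnth_mktuple eqxx.
by rewrite tnth_mktuple (negPf neq_jk).
Qed.

End Antipode.

(** * Points of the unit circle and integrality *)

Section Cis.
Variable R : realType.
Implicit Types x y : R.

Lemma cis0 : cis (0 : R) = 1.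
Proof. by rewrite /cis cos0 sin0 rmorph1 rmorph0 mulr0 addr0. Qed.

Lemma cisD x y : cis (x + y) = cis x * cis y.
Proof.
rewrite /cis cosD sinD rmorphB rmorphD !rmorphM /=.
have i2 := sqrCi R[i]; rewrite expr2 in i2.
rewrite !mulrDl !mulrDr [in RHS]mulrCA mulrA mulrACA i2; ring.
Qed.

Lemma cisN x : cis (- x) = (cis x)^*%R.
Proof.
rewrite /cis cosN sinN rmorphD rmorphM rmorphN /= conjCi.
by rewrite !conj_Creal ?complex_real ?mulrN ?mulNr.
Qed.

Lemma norm_cis x : `|cis x| = 1.
Proof.
by apply/eqP; rewrite -sqrp_eq1 // normCK -cisN -cisD subrr cis0.
Qed.

Lemma cis_neq0 x : cis x != 0.
Proof. by rewrite -normr_eq0 norm_cis oner_eq0. Qed.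

Lemma cisB x y : cis (x - y) = cis x / cis y.
Proof. by apply: (mulIf (cis_neq0 y)); rewrite divfK ?cis_neq0 // -cisD subrK. Qed.

Lemma cisMn x k : cis (x *+ k) = cis x ^+ k.
Proof.
elim: k => [|k IHk]; first by rewrite mulr0n cis0.
by rewrite mulrS cisD IHk exprS.
Qed.

Lemma cis_eq1 x : cis x = 1 <-> cos x = 1.
Proof.
have cisE y : cis y = Complex (cos y) (sin y).
  rewrite /cis -complexiE; apply/eqP.
  by rewrite eq_complex /= !(mul0r, mul1r, mulr0, addr0, add0r, subr0) !eqxx.
rewrite cisE; split=> [[]//|cx]; have := cos2Dsin2 x.
rewrite cx expr1n -[X in _ = X]addr0 => /addrI/eqP; rewrite sqrf_eq0 => /eqP ->.
by [].
Qed.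

Lemma cis_2pi_eq1 x : cis (pi *+ 2 * x) = 1 <-> x \is a Num.int.
Proof.
have cis_int (z : int) : cis ((pi : R) *+ 2 * z%:~R) = 1.
  have nat_case k : cis ((pi : R) *+ 2 * k%:R) = 1.
    rewrite mulr_natr; have -> := cisMn (pi *+ 2) k.
    by have /cis_eq1 -> := cos2pi R; rewrite expr1n.
  case: z => k; first exact: nat_case.
  by rewrite NegzE rmorphN mulrN cisN nat_case rmorph1.
split=> [|/intrP[z ->]]; last exact: cis_int.
(* Only the fractional part [y] matters. The double angle formula then gives [sin (pi * y) = 0],
   which is impossible for [0 < y < 1]. *)
rewrite -[x](subrK (Num.floor x)%:~R) mulrDr cisD cis_int mulr1.
set y := x - _ => /cis_eq1.
have [y_ge0 y_lt1] : 0 <= y /\ y < 1.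
  by split; [rewrite subr_ge0 floor_le|rewrite ltrBlDl -[1]/(1%:~R) -intrD floorD1_gt].
rewrite mulrnAl cos_mulr2n => cy.
have s0 : sin (pi * y) = 0.
  apply/eqP; rewrite -sqrf_eq0; have := cos2Dsin2 (pi * y); lra.
have y0 : y = 0.
  apply/eqP; case: (ltgtP y 0) y_ge0 => // y_gt0 _.
  have : 0 < sin (pi * y).
    by apply: sin_gt0_pi; rewrite mulr_gt0 ?pi_gt0 //= gtr_pMr ?pi_gt0.
  by rewrite s0 ltxx.
by rewrite y0 add0r intr_int.
Qed.

End Cis.

(** * Lattices of polynomials and powers of two *)

Lemma binz_sub_small (a k j : nat) : (k < j)%N -> binz a (k%:Z - j%:Z) = 0%N.
Proof.
move=> kj; rewrite -opprB subzn 1?ltnW //.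
by move: kj; rewrite -subn_gt0 => /prednK <-; rewrite -NegzE.
Qed.

Lemma binz_sub (a k j : nat) : (j <= k)%N -> binz a (k%:Z - j%:Z) = 'C(a, k - j).
Proof. by move=> jk; rewrite subzn. Qed.

Section Arithmetic.
Variable R : realType.

Lemma int_binomial_basis (S : comNzRingType) (f : S -> R) (a b : S) (N : nat) :
  (forall p q, f (p - q) = f p - f q) ->
  (forall k, (k <= N)%N -> f (b ^+ k * a ^+ (N - k)) \is a Num.int) ->
  forall s, (s <= N)%N -> f ((a - b) ^+ s * a ^+ (N - s)) \is a Num.int.
Proof.
move=> fB fint.
(* Mixed products are needed for the induction: expanding one factor [a - b] lowers [s] and leaves a
   difference of terms with [t] and [t.+1]. *)
suff gen s t : (s + t <= N)%N ->
    f ((a - b) ^+ s * (b ^+ t * a ^+ (N - (s + t)))) \is a Num.int.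
  by move=> s sN; have := gen s 0%N; rewrite addn0 expr0 mul1r; apply.
elim: s t => [|s IHs] t stN; first by rewrite expr0 mul1r fint.
have -> : (a - b) ^+ s.+1 * (b ^+ t * a ^+ (N - (s.+1 + t)))
    = (a - b) ^+ s * (b ^+ t * a ^+ (N - (s + t)))
      - (a - b) ^+ s * (b ^+ t.+1 * a ^+ (N - (s + t.+1))).
  rewrite addSn addnS (_ : N - (s + t) = (N - (s + t).+1).+1)%N.
    by rewrite !exprS; ring.
  by rewrite subnSK // -addSn.
by rewrite fB rpredB ?IHs ?addnS -?addSn // (leq_trans _ stN) ?leq_add2r.
Qed.

Lemma coef_1DXn (S : comNzRingType) m k : ((1 + 'X : {poly S}) ^+ m)`_k = 'C(m, k)%:R.
Proof.
rewrite exprDn coef_sum.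
under eq_bigr do rewrite expr1n mul1r coefMn coefXn.
case: (ltnP k m.+1) => [lt_km|lt_mk]; last first.
  rewrite bin_small // big1 // => i _.
  by case: eqP => [ki|]; rewrite ?mul0rn //; move: (ltn_ord i); rewrite -ki ltnNge lt_mk.
rewrite (bigD1 (Ordinal lt_km)) //= eqxx big1 ?addr0 // => i /negPf neq_ik.
by case: eqP => [ki|]; rewrite ?mul0rn //; rewrite -val_eqE /= -ki eqxx in neq_ik.
Qed.

(** Covers the sums in both minima: [N = n] for [full_min], and [N = n.-1] with [num_proper] indices
    for [lower_min]. *)
Definition binsum (l : nat) (r : nat -> nat) (N j : nat) : nat :=
  \sum_(1 <= i < l.+1) binz (N - j) ((r i)%:Z - j%:Z).

(** The additive functional whose value at [krawpoly int n s] is [eigval n l r s]. *)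
Definition coefsum (l : nat) (r : nat -> nat) (p : {poly int}) : int :=
  \sum_(1 <= i < l.+1) p`_(r i).

Lemma coefsumB l r p q : coefsum l r (p - q) = coefsum l r p - coefsum l r q.
Proof. by rewrite /coefsum -sumrB; apply: eq_bigr => i _; rewrite coefB. Qed.

Lemma coefsum_binsum l r N j :
  coefsum l r ((2 *: 'X) ^+ j * (1 + 'X) ^+ (N - j)) = (2 ^ j * binsum l r N j)%:Z.
Proof.
rewrite /coefsum /binsum big_distrr /= -[RHS]natz natr_sum.
apply: eq_bigr => i _; rewrite exprZn -scalerAl coefZ coefXnM coef_1DXn.
rewrite natrM natrX; congr (_ * _).
by case: ltnP => [/binz_sub_small ->|/binz_sub ->].
Qed.

(** With [a = 1 + 'X], each of [1 - 'X] and [2 *: 'X] is [a] minus the other, so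
    [int_binomial_basis] applies in both directions. The extra factor [2 *: 'X] turns the exponent
    [k] into [j = k.+1], which is why [j] starts at 1. *)
Lemma int_differences_basis l r N (x : R) :
  (forall s, (s < N)%N ->
     x * (coefsum l r (krawpoly int N.-1 s * (2 *: 'X)))%:~R \is a Num.int)
  <-> (forall j, (0 < j <= N)%N -> x * (2 ^ j * binsum l r N j)%:R \is a Num.int).
Proof.
pose f (p : {poly int}) := x * (coefsum l r (p * (2 *: 'X)))%:~R.
have fB p q : f (p - q) = f p - f q by rewrite /f mulrBl coefsumB rmorphB mulrBr.
have fQ k : (k < N)%N ->
    f ((2 *: 'X) ^+ k * (1 + 'X) ^+ (N.-1 - k)) = x * (2 ^ k.+1 * binsum l r N k.+1)%:R.
  by move=> kN; rewrite /f mulrAC -exprSr -predn_sub -subnS coefsum_binsum.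
have eq1 : (1 - 'X : {poly int}) = (1 + 'X) - 2 *: 'X.
  by rewrite scaler_nat; ring.
have eq2 : (2 *: 'X : {poly int}) = (1 + 'X) - (1 - 'X).
  by rewrite scaler_nat; ring.
split=> H.
  case=> // j /andP[_ jN]; rewrite -fQ // eq2.
  apply: int_binomial_basis => //; last by case: (N) jN.
  by move=> k kN; apply: H; case: (N) kN jN.
move=> s sN; rewrite -/(f _) /krawpoly eq1.
apply: int_binomial_basis => //; last by case: (N) sN.
move=> k kN; rewrite fQ; first by apply: H; case: (N) kN sN.
by case: (N) kN sN.
Qed.

Lemma minseq_le m F j : (0 < j <= m)%N -> (minseq m F <= F j)%N.
Proof.
move=> jm; have : j \in index_iota 1 m.+1 by rewrite mem_index_iota ltnS.
rewrite /minseq; elim: index_iota => //= i s IHs.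
by rewrite inE big_cons geq_min => /predU1P[->|/IHs ->]; rewrite ?leqnn ?orbT.
Qed.

Lemma minseq_attained m F : (0 < m)%N -> exists2 j, (0 < j <= m)%N & minseq m F = F j.
Proof.
move=> m_gt0; rewrite /minseq big_nat_cond.
elim/big_ind : _ => [|y z [j jm ->] [k km ->]|j /andP[/andP[j0 jm] _]].
- by exists 1%N.
- by rewrite /minn; case: ifP => _; [exists j|exists k].
- by exists j; rewrite ?j0.
Qed.

(* The numbers [2 ^ j * S j] have a power of two as their greatest common
   divisor because [2 ^ m] is one of them. *)
Lemma int_minseq (m N : nat) (S : nat -> nat) (x : R) :
  (0 < m <= N)%N -> S m = 1%N ->
  (forall j, (0 < j <= m)%N -> (0 < S j)%N) -> (forall j, (m < j)%N -> S j = 0%N) ->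
  (forall j, (0 < j <= N)%N -> x * (2 ^ j * S j)%:R \is a Num.int)
  <-> x * 2 ^+ minseq m (fun j => j + alpha2 (S j))%N \is a Num.int.
Proof.
move=> /andP[m_gt0 mN] Sm Spos S0; set F := fun j => _; set d := minseq m F.
have SE j : (0 < j <= m)%N -> exists2 q, odd q & (2 ^ j * S j = 2 ^ (F j) * q)%N.
  move=> /Spos Sj; have [q] := pfactor_coprime (p := 2) isT Sj.
  by rewrite coprime2n => oq ->; exists q => //; rewrite expnD -mulnA [(_ * q)%N]mulnC.
split=> H.
  have [j jm dE] := minseq_attained F m_gt0.
  have [q oq qE] := SE j jm.
  have xq : x * 2 ^+ d * q%:R \is a Num.int.
    have jN : (0 < j <= N)%N by case/andP: jm => -> /= jm; exact: leq_trans jm mN.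
    by have := H j jN; rewrite qE natrM natrX mulrA /d dE.
  (* The term at [m] is [2 ^ m] itself, since [S m = 1] has no factor 2. *)
  have dm : (d <= m)%N.
    by have := @minseq_le m F m; rewrite m_gt0 leqnn /F Sm /alpha2 logn1 addn0; apply.
  have xm : x * 2 ^+ d * (2 ^ (m - d))%:R \is a Num.int.
    by have := H m; rewrite m_gt0 mN Sm muln1 natrX natrX -mulrA -exprD subnKC //; apply.
  (* Bezout for the odd cofactor [q] and the power [2 ^ (m - d)] removes [q] from
     [x * 2 ^+ d * q%:R]. *)
  have [|u v uv _] := @egcdnP q (2 ^ (m - d)) _; first by case: (q) oq.
  have cop : coprime q (2 ^ (m - d)) by rewrite coprimeXr // coprimen2.
  move: uv; rewrite (eqP cop) => /(congr1 (fun k => k%:R : R)).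
  rewrite natrD !natrM => uv.
  set p := (2 ^ (m - d))%:R in uv xm *.
  have -> : x * 2 ^+ d = u%:R * (x * 2 ^+ d * q%:R) - v%:R * (x * 2 ^+ d * p).
    by rewrite ![_%:R * (x * _ * _)]mulrCA -mulrBr uv addrC addKr mulr1.
  by rewrite rpredB // rpredM // rpred_nat.
move=> j /andP[j0 jN]; case: (leqP j m) => [jm|/S0 ->]; last by rewrite muln0 mulr0 rpred0.
have j0m : (0 < j <= m)%N by rewrite j0.
have [q _ ->] := SE j j0m; rewrite natrM natrX mulrA.
rewrite -(subnKC (minseq_le F j0m)) exprD mulrA -/d.
by rewrite rpredM ?rpred_nat // rpredM // rpredX // rpred_nat.
Qed.

End Arithmetic.

(** * Binomial sums over an increasing sequence of distances *)

Section Increasing.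
Variables (l : nat) (r : nat -> nat).
Hypothesis l_gt0 : (0 < l)%N.
Hypothesis r_incr : forall i, (1 <= i < l)%N -> (r i < r i.+1)%N.

Lemma increasing_lt i j : (0 < i < j)%N -> (j <= l)%N -> (r i < r j)%N.
Proof.
elim: j => [|j IHj] /andP[i0 ij] jl //.
move: ij; rewrite ltnS leq_eqVlt => /predU1P[eij|ij].
  by subst j; apply: r_incr; rewrite i0.
apply: (@ltn_trans (r j)); first by rewrite IHj ?i0 // ltnW.
by apply: r_incr; rewrite (leq_trans i0 (ltnW ij)).
Qed.

Lemma increasing_inj : {in iota 1 l &, injective r}.
Proof.
move=> i j; rewrite !mem_iota !add1n !ltnS => /andP[i0 il] /andP[j0 jl] rij.
case: (ltngtP i j) => // ij.
  by have := increasing_lt (i := i) (j := j); rewrite i0 ij rij ltnn => /(_ isT jl).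
by have := increasing_lt (i := j) (j := i); rewrite j0 ij rij ltnn => /(_ isT il).
Qed.

Lemma increasing_le i : (0 < i <= l)%N -> (r i <= r l)%N.
Proof.
move=> /andP[i0]; rewrite leq_eqVlt => /predU1P[->//|il].
by rewrite ltnW // increasing_lt // i0.
Qed.

Lemma binsum_last N : binsum l r N (r l) = 1%N.
Proof.
rewrite /binsum big_nat_recr //= binz_sub // subnn bin0 big_nat big1 // => i /andP[i0 il].
by rewrite binz_sub_small // increasing_lt ?i0.
Qed.

(** The term of the largest index is positive. This keeps [alpha2] away from 0, where [logn] takes
    the default value 0. *)
Lemma binsum_gt0 N j : (r l <= N)%N -> (j <= r l)%N -> (0 < binsum l r N j)%N.
Proof.
move=> rN jr; rewrite /binsum big_nat_recr //= binz_sub //.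
by rewrite addn_gt0 bin_gt0 leq_sub2r // orbT.
Qed.

Lemma binsum_eq0 N j : (r l < j)%N -> binsum l r N j = 0%N.
Proof.
move=> rj; rewrite /binsum big_nat big1 // => i /andP[i0 il].
by rewrite binz_sub_small // (leq_ltn_trans _ rj) // increasing_le ?i0.
Qed.

End Increasing.

(** * Integrality of multiples of eigenvalue differences *)

Lemma krawpoly_sub1 (S : comNzRingType) m s : (s < m)%N ->
  krawpoly S m s - krawpoly S m s.+1 = krawpoly S m.-1 s * (2 *: 'X : {poly S}).
Proof.
case: m => // m sm; rewrite /krawpoly succnK subSS subSn //.
by rewrite (exprS _ s) (exprS _ (m - s)) scaler_nat; ring.
Qed.

(** From [(1 + 'X)^2 - (1 - 'X)^2 = 4 'X]; the factor 2 in front accounts for the successor in the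
    exponent of [int_eigval_sub2]. *)
Lemma krawpoly_sub2 (S : comNzRingType) m s : (s.+1 < m)%N ->
  krawpoly S m s - krawpoly S m s.+2
    = 2 *: (krawpoly S m.-2 s * (2 *: 'X : {poly S})).
Proof.
case: m => [|[|m]] // sm.
have le_sm : (s <= m)%N by [].
rewrite /krawpoly !succnK !subSS (subSn (leqW le_sm)) (subSn le_sm).
by rewrite (exprS _ s.+1) (exprS _ s) (exprS _ (m - s).+1) (exprS _ (m - s)) !scaler_nat; ring.
Qed.

Section Denominators.
Variables (R : realType) (n l : nat) (r : nat -> nat).
Hypothesis l_gt0 : (0 < l)%N.
Hypothesis r1_gt0 : (0 < r 1)%N.
Hypothesis r_incr : forall i : nat, (1 <= i < l)%N -> (r i < r i.+1)%N.
Hypothesis rl_le : (r l <= n)%N.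

Lemma int_eigval_sub1 (x : R) :
  (forall s, (s < n)%N ->
     x * (eigval n l r s - eigval n l r s.+1)%:~R \is a Num.int)
  <-> x * 2 ^+ full_min n l r \is a Num.int.
Proof.
have rl_gt0 : (0 < r l)%N.
  by apply: (leq_trans r1_gt0); apply: (increasing_le r_incr); rewrite l_gt0.
apply: iff_trans (@int_minseq R (r l) n (binsum l r n) x _ _ _ _).
- apply: iff_trans (int_differences_basis l r n x).
  by split=> H s sn; move: (H s sn); rewrite -coefsumB krawpoly_sub1.
- by rewrite rl_gt0.
- exact: binsum_last.
- by move=> j /andP[_]; exact: binsum_gt0.
- exact: binsum_eq0.
Qed.

Hypothesis neq_Xn : ~ (@hamming_union n l r =2 @hamming_graph n n).
Let l' := num_proper n l r.

(** This is where [neq_Xn] enters: no index would be left only for [l = 1] and [r 1 = n]. *)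
Lemma num_proper_gt0 : (0 < l')%N.
Proof.
rewrite /l' /num_proper; case: eqP => // rln.
rewrite lt0n; apply/eqP => l1; apply: neq_Xn => u v.
rewrite /hamming_union (_ : l = 1%N) /= ?orbF; last by case: (l) l_gt0 l1 => // -[].
by move: rln; case: (l) l_gt0 l1 => // -[] // _ _ ->.
Qed.

Lemma num_proper_le : (l' <= l)%N.
Proof. by rewrite /l' /num_proper; case: eqP => // _; rewrite leq_pred. Qed.

Lemma num_proper_lt : (r l' < n)%N.
Proof.
move: num_proper_gt0; rewrite /l' /num_proper; case: eqP => [<- l1|rln _].
  by have := r_incr (i := l.-1); rewrite prednK // l1 leqnn; apply.
by rewrite ltn_neqAle rl_le andbT; apply/eqP.
Qed.

(** If [r l = n], the omitted term is ['C(n.-1 - j, n - j)], which vanishes. *)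
Lemma binsum_num_proper j : (0 < j <= n.-1)%N -> binsum l r n.-1 j = binsum l' r n.-1 j.
Proof.
move=> /andP[j0 jn]; have n0 : (0 < n)%N by exact: leq_trans (leq_trans j0 jn) (leq_pred n).
rewrite /l' /num_proper; case: eqP => // rln.
rewrite -[in LHS](prednK l_gt0) /binsum big_nat_recr /=; last by rewrite prednK.
rewrite prednK // rln binz_sub; last by rewrite (leq_trans jn) ?leq_pred.
by rewrite bin_small ?addn0 // ltn_sub2r // ?prednK //; rewrite (leq_ltn_trans jn) // prednK.
Qed.

Lemma int_eigval_sub2 (x : R) :
  (forall s, (s.+1 < n)%N ->
     x * (eigval n l r s - eigval n l r s.+2)%:~R \is a Num.int)
  <-> x * 2 ^+ (lower_min n l r).+1 \is a Num.int.
Proof.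
have r_incr' i : (1 <= i < l')%N -> (r i < r i.+1)%N.
  by move=> /andP[i0 il]; rewrite r_incr ?i0 // (leq_trans il) ?num_proper_le.
have n_gt0 : (0 < n)%N by apply: leq_ltn_trans num_proper_lt.
have rl_gt0 : (0 < r l')%N.
  apply: (leq_trans r1_gt0); apply: (increasing_le r_incr').
  by rewrite num_proper_gt0.
have -> : lower_min n l r = minseq (r l') (fun j => j + alpha2 (binsum l' r n.-1 j))%N.
  by rewrite /lower_min; congr minseq; apply/funext => j; rewrite -subn1 subnAC.
rewrite exprS mulrA.
apply: iff_trans (@int_minseq R (r l') n.-1 (binsum l' r n.-1) (x * 2) _ _ _ _).
- apply: (@iff_trans _ (forall j, (0 < j <= n.-1)%N ->
     x * 2 * (2 ^ j * binsum l r n.-1 j)%:R \is a Num.int)); last first.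
    by split=> H j jn; have := H j jn; rewrite binsum_num_proper.
  apply: iff_trans (int_differences_basis l r n.-1 (x * 2)).
  have sub2 s : (s.+1 < n)%N -> x * (eigval n l r s - eigval n l r s.+2)%:~R
      = x * 2 * (coefsum l r (krawpoly int n.-2 s * (2 *: 'X)))%:~R.
    move=> sn; rewrite -coefsumB krawpoly_sub2 // /coefsum.
    under eq_bigr do rewrite coefZ.
    by rewrite -mulr_sumr rmorphM mulrA.
  split=> H s sn; first by rewrite -sub2 ?H // -(prednK n_gt0).
  by rewrite sub2 // H // -ltnS prednK.
- by rewrite rl_gt0 -ltnS prednK // num_proper_lt.
- by apply: binsum_last => //; exact: num_proper_gt0.
- move=> j /andP[_]; apply: binsum_gt0; first exact: num_proper_gt0.
  by rewrite -ltnS prednK // num_proper_lt.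
- exact: binsum_eq0.
Qed.

End Denominators.

(** * Revival expressed by the phases of the eigenvalues *)

Section RevivalCriterion.
Variables (R : realType) (n l : nat) (r : nat -> nat).
Hypothesis r_inj : {in iota 1 l &, injective r}.
Local Notation graph := (@hamming_union n l r).

Definition phase (tau : R) (s : nat) : R[i] := cis (- (tau * (eigval n l r s)%:~R)).

Lemma revival_at_antipode (a b : n.-tuple bool) (tau : R) (alpha beta : R[i]) :
  revival_at graph a b tau alpha beta ->
  forall s, (s <= n)%N -> phase tau s = alpha + beta * (-1) ^+ s.
Proof.
move=> [neq_ab _ eq_ab beta_neq0 _].
have eq_chi u w : chi R[i] u b = chi R[i] u a * w ->
    phase tau (weight u) = alpha + beta * w.
  move: eq_ab; rewrite (walkmxE n tau r_inj) => /spectral_vertexv/(_ u) eq_u chi_b.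
  have chi_neq0 : chi R[i] u a != 0.
    by apply: contraNneq (oner_neq0 R[i]) => chi0; rewrite -(chi_mul_self _ u a) chi0 mul0r.
  apply: (mulIf chi_neq0); rewrite /phase eq_u chi_b; ring.
(* All characters of weight one share a phase. It would equal [alpha + beta] at a coordinate where
   [a] and [b] agree, and equals [alpha - beta] where they differ; both cannot occur as [beta] is
   nonzero. *)
have anti k : tnth a k != tnth b k.
  have [k0 neq_k0] : exists k, tnth a k != tnth b k.
    apply/existsP; apply: contraNT neq_ab; rewrite negb_exists => /forallP eq_t.
    by apply/eqP/eq_from_tnth => j; apply/eqP; rewrite -[_ == _]negbK.
  apply: contraNneq beta_neq0 => eq_k.
  have [u [wu /eq_chi]] := chi_singleton R[i] a b k.
  have [v [wv /eq_chi]] := chi_singleton R[i] a b k0.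
  rewrite eq_k eqxx neq_k0 wu wv mulr1 mulrN1 => -> /addrI/eqP.
  by rewrite eq_sym -addr_eq0 -mulr2n mulrn_eq0.
move=> s le_sn; have := chi_antipode R[i] (initial_ones n s) anti.
by move/eq_chi; rewrite weight_initial_ones.
Qed.

Lemma antipode_revival_at (tau : R) (alpha beta : R[i]) :
  (0 < n)%N -> 0 < tau -> beta != 0 ->
  (forall s, (s <= n)%N -> phase tau s = alpha + beta * (-1) ^+ s) ->
  revival_at graph (initial_ones n 0) (initial_ones n n) tau alpha beta.
Proof.
move=> n_gt0 tau_gt0 beta_neq0 eq_phase.
have anti k : tnth (initial_ones n 0) k != tnth (initial_ones n n) k.
  by rewrite !tnth_mktuple ltn_ord.
split=> //.
- by apply/eqP => eq_ab; have := anti (Ordinal n_gt0); rewrite eq_ab eqxx.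
- rewrite (walkmxE n tau r_inj); apply/spectral_vertexv => u.
  rewrite -/(phase tau (weight u)) eq_phase ?weight_le //.
  by rewrite (chi_antipode R[i] u anti); ring.
(* Phases have modulus one, so [alpha + beta] and [alpha - beta] do (weights 0 and 1), and the
   parallelogram law gives the normalization. *)
have norm1 s : (s <= n)%N -> `|alpha + beta * (-1) ^+ s| = 1.
  by move=> /eq_phase <-; exact: norm_cis.
have := norm1 0%N isT; have := norm1 1%N n_gt0; rewrite expr0 expr1 mulrN1 mulr1.
move=> /(congr1 (fun z => z ^+ 2)) nB /(congr1 (fun z => z ^+ 2)) nD.
have : `|alpha - beta| ^+ 2 + `|alpha + beta| ^+ 2
    = 2 * (`|alpha| ^+ 2 + `|beta| ^+ 2) by rewrite !normCK rmorphB rmorphD /=; ring.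
rewrite nB nD expr1n -[1 + 1]/(2 : R[i]) => /esym/eqP.
by rewrite -subr_eq0 -[X in _ - X]mulr1 -mulrBr mulf_eq0 pnatr_eq0 subr_eq0 => /eqP.
Qed.

(** Time is measured in units of [2 pi]. The power [k] allows squares of phases to be compared, as
    balanced revival requires. *)
Lemma phase_eq (x : R) (k s t : nat) :
  phase (pi *+ 2 * x) s ^+ k = phase (pi *+ 2 * x) t ^+ k
  <-> x * k%:R * (eigval n l r s - eigval n l r t)%:~R \is a Num.int.
Proof.
have expand (p A B : R) :
    p * (x * k%:R * (A - B)) = - (p * x * B) *+ k - (- (p * x * A) *+ k).
  by ring.
rewrite -cis_2pi_eq1 /phase -!cisMn.
set u := _ *+ k; set v := _ *+ k.
have -> : pi *+ 2 * (x * k%:R * (eigval n l r s - eigval n l r t)%:~R) = v - u.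
  by rewrite rmorphB; exact: expand.
rewrite cisB; split=> [->|]; first by rewrite divff ?cis_neq0.
by move/(congr1 ( *%R^~ (cis u))); rewrite divfK ?cis_neq0 // mul1r.
Qed.

End RevivalCriterion.

(** * Admissible times, perfect transfer and balanced revival *)

Section Times.
Variables (R : realType) (n l : nat) (r : nat -> nat).
Hypothesis l_gt0 : (0 < l)%N.
Hypothesis r1_gt0 : (0 < r 1)%N.
Hypothesis r_incr : forall i : nat, (1 <= i < l)%N -> (r i < r i.+1)%N.
Hypothesis rl_le : (r l <= n)%N.
Hypothesis neq_Xn : ~ (@hamming_union n l r =2 @hamming_graph n n).
Let r_inj : {in iota 1 l &, injective r} := increasing_inj r_incr.
Local Notation graph := (@hamming_union n l r).
Local Notation full := (full_min n l r).
Local Notation lower := (lower_min n l r).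
Local Notation ph x := (phase n l r (pi *+ 2 * (x : R))).

Lemma dim_gt0 : (0 < n)%N.
Proof.
apply: leq_trans rl_le; apply: (leq_trans r1_gt0).
by apply: (increasing_le r_incr); rewrite l_gt0.
Qed.

Lemma phase_parity (x : R) : x * 2 ^+ lower.+1 \is a Num.int ->
  forall s, (s <= n)%N -> ph x s = if odd s then ph x 1 else ph x 0.
Proof.
move=> /(int_eigval_sub2 l_gt0 r1_gt0 r_incr rl_le neq_Xn) x_int.
(* The claim is carried for [s] and [s.+1] together because the phases recur with step two. *)
suff both s : ((s <= n)%N -> ph x s = if odd s then ph x 1 else ph x 0) /\
    ((s.+1 <= n)%N -> ph x s.+1 = if odd s.+1 then ph x 1 else ph x 0).
  by move=> s; have [] := both s.
elim: s => [|s [IHs IHs1]]; split => // sn.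
rewrite /= negbK -IHs; last by rewrite (leq_trans _ sn) // ltnW.
have /phase_eq : x * 1%:R * (eigval n l r s - eigval n l r s.+2)%:~R \is a Num.int.
  by rewrite mulr1 x_int.
by rewrite !expr1 => ->.
Qed.

Lemma phase01_eq (x : R) (k : nat) : x * 2 ^+ lower.+1 \is a Num.int ->
  ph x 0 ^+ k = ph x 1 ^+ k <-> x * k%:R * 2 ^+ full \is a Num.int.
Proof.
move=> x_int; rewrite -(int_eigval_sub1 l_gt0 r1_gt0 r_incr rl_le (x * k%:R)).
split=> [eq01 s sn|/(_ 0%N dim_gt0)/phase_eq //].
(* Consecutive phases are those at 0 and 1 in one of the two orders, so one equality yields all of
   them. *)
apply/phase_eq; rewrite (phase_parity x_int sn) (phase_parity x_int (ltnW sn)).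
by rewrite oddS; case: (odd s); [exact: esym eq01|exact: eq01].
Qed.

Lemma revival_phases (a b : n.-tuple bool) (tau : R) (alpha beta : R[i]) :
  revival_at graph a b tau alpha beta ->
  exists x : R, [/\ x * 2 ^+ lower.+1 \is a Num.int,
    ~ x * 2 ^+ full \is a Num.int & ph x 0 + ph x 1 = alpha *+ 2].
Proof.
move=> rev; have eq_phase := revival_at_antipode r_inj rev.
have beta_neq0 : beta != 0 by case: rev.
exists (tau / (pi *+ 2)).
have -> : pi *+ 2 * (tau / (pi *+ 2)) = tau.
  by rewrite mulrC divfK // mulrn_eq0 /= gt_eqF ?pi_gt0.
have n_gt0 := dim_gt0; set x := tau / _.
have tauE : tau = pi *+ 2 * x.
  by rewrite /x mulrC divfK // mulrn_eq0 /= gt_eqF ?pi_gt0.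
have x_int : x * 2 ^+ lower.+1 \is a Num.int.
  apply/(int_eigval_sub2 l_gt0 r1_gt0 r_incr rl_le neq_Xn) => s sn.
  have /phase_eq : ph x s ^+ 1 = ph x s.+2 ^+ 1.
    rewrite -tauE (eq_phase _ sn) (eq_phase _ (ltnW (ltnW sn))).
    by rewrite !exprS !mulN1r opprK.
  by rewrite mulr1.
split=> //; last by rewrite !eq_phase // expr0 expr1 mulr2n; ring.
move=> x_full; have /(phase01_eq 1 x_int) : x * 1%:R * 2 ^+ full \is a Num.int.
  by rewrite mulr1.
rewrite !expr1 -tauE !eq_phase // expr0 expr1 mulr1 mulrN1 => /addrI/eqP.
by rewrite -addr_eq0 -mulr2n mulrn_eq0 (negPf beta_neq0).
Qed.

(** The coefficients solve [alpha + beta = ph x 0] and [alpha - beta = ph x 1]. *)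
Lemma phases_revival (x : R) : 0 < x ->
  x * 2 ^+ lower.+1 \is a Num.int -> ~ x * 2 ^+ full \is a Num.int ->
  revival_at graph (initial_ones n 0) (initial_ones n n) (pi *+ 2 * x)
    ((ph x 0 + ph x 1) / 2) ((ph x 0 - ph x 1) / 2).
Proof.
move=> x_gt0 x_int x_full; apply: antipode_revival_at => //.
- exact: dim_gt0.
- by rewrite mulr_gt0 // pmulrn_lgt0 // pi_gt0.
- rewrite mulf_neq0 ?invr_neq0 ?pnatr_eq0 // subr_eq0; apply/eqP => eq01.
  apply: x_full; rewrite -[x]mulr1; apply/(phase01_eq 1 x_int).
  by rewrite !expr1.
move=> s /(phase_parity x_int) ->; rewrite -signr_odd.
by case: odd; rewrite ?expr0 ?expr1; field.
Qed.

(** The two powers differ but have equal squares. *)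
Lemma phase01_opp (x : R) (k : nat) : x * 2 ^+ lower.+1 \is a Num.int ->
  ~ x * k%:R * 2 ^+ full \is a Num.int -> x * k%:R * 2 ^+ full.+1 \is a Num.int ->
  ph x 0 ^+ k = - ph x 1 ^+ k.
Proof.
move=> x_int x_k x_2k; apply/eqP.
have /eqP : ph x 0 ^+ k ^+ 2 = ph x 1 ^+ k ^+ 2.
  rewrite -!exprM; apply/(phase01_eq _ x_int).
  by rewrite natrM mulrA -mulrA -exprS.
by rewrite eqf_sqr => /orP[/eqP/(phase01_eq _ x_int)//|].
Qed.

Lemma inv_pow2_int (k m : nat) : ((2 ^- k * 2 ^+ m : R) \is a Num.int) = (k <= m)%N.
Proof.
apply/idP/idP => [x_int|km]; last first.
  by rewrite -(subnKC km) exprD mulKf ?expf_neq0 ?pnatr_eq0 // rpredX // rpred_nat.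
have x_gt0 : 0 < 2 ^- k * 2 ^+ m :> R by rewrite mulr_gt0 ?invr_gt0 ?exprn_gt0.
have := norm_intr_ge1 x_int (lt0r_neq0 x_gt0).
rewrite gtr0_norm // mulrC ler_pdivlMr ?exprn_gt0 // mul1r ler_eXn2l //.
by rewrite ltr1n.
Qed.

Lemma perfect_transfer_of_le : (full <= lower)%N -> perfect_state_transfer R graph.
Proof.
move=> le_fl; set x : R := 2 ^- full.+1.
have x_int : x * 2 ^+ lower.+1 \is a Num.int by rewrite inv_pow2_int.
have x_full : ~ x * 2 ^+ full \is a Num.int by rewrite inv_pow2_int ltnn.
exists (initial_ones n 0), (initial_ones n n), (pi *+ 2 * x).
exists ((ph x 0 + ph x 1) / 2), ((ph x 0 - ph x 1) / 2); split.
  by apply: phases_revival => //; rewrite invr_gt0 exprn_gt0.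
have := @phase01_opp x 1 x_int; rewrite mulr1 !expr1 => ->//.
  by rewrite addNr mul0r.
by rewrite inv_pow2_int.
Qed.

(** The hypothesis gives [(c + d)^2 = 2 c d], so the half-sum has squared modulus [1 / 2]. *)
Lemma norm_half_of_sqr (c d : R[i]) : `|c| = 1 -> `|d| = 1 ->
  c ^+ 2 = - d ^+ 2 -> `|(c + d) / 2| = (sqrtC 2)^-1.
Proof.
move=> c1 d1 cd.
apply/eqP; rewrite -(@eqrXn2 _ 4) ?normr_ge0 ?invr_ge0 ?sqrtC_ge0 //.
have -> : 4%N = (2 * 2)%N by [].
rewrite !exprM -normrX exprVn sqrtCK.
have -> : ((c + d) / 2) ^+ 2 = c * d / 2.
  by rewrite expr_div_n sqrrD cd; field.
by rewrite normf_div normrM c1 d1 normr_nat !mul1r.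
Qed.

Lemma balanced_of_lt : (full < lower)%N -> balanced_revival R graph.
Proof.
(* Half the time of perfect transfer: the squares of the phases are opposite, so the phases are a
   quarter turn apart. Strictness makes this [x] admissible. *)
move=> lt_fl; set x : R := 2 ^- full.+2.
have x_int : x * 2 ^+ lower.+1 \is a Num.int by rewrite inv_pow2_int.
have x_full : ~ x * 2 ^+ full \is a Num.int by rewrite inv_pow2_int ltnNge leqnSn.
have sqr_opp : ph x 0 ^+ 2 = - ph x 1 ^+ 2.
  apply: phase01_opp => //; rewrite -mulrA -exprS inv_pow2_int //.
  by rewrite ltnn.
exists (initial_ones n 0), (initial_ones n n), (pi *+ 2 * x).
exists ((ph x 0 + ph x 1) / 2), ((ph x 0 - ph x 1) / 2); split.
- by apply: phases_revival => //; rewrite invr_gt0 exprn_gt0.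
- by apply: norm_half_of_sqr => //; exact: norm_cis.
(* Applied to [ph x 0] and [- ph x 1]. *)
- by apply: norm_half_of_sqr; rewrite ?normrN ?sqrrN //; exact: norm_cis.
Qed.

End Times.

Theorem theorem4p4 (R : realType) (n l : nat) (r : nat -> nat)
    (l_gt0 : (0 < l)%N)
    (r1_gt0 : (0 < r 1)%N)
    (r_incr : forall i : nat, (1 <= i < l)%N -> (r i < r i.+1)%N)
    (rl_le : (r l <= n)%N)
    (neq_Xn : ~ (@hamming_union n l r =2 @hamming_graph n n)) :
  [/\ fractional_revival R (@hamming_union n l r)
        <-> (lower_min n l r >= full_min n l r)%N,
      lower_min n l r = full_min n l r ->
        perfect_state_transfer R (@hamming_union n l r)
        /\ only_perfect_revival R (@hamming_union n l r)
    & (lower_min n l r > full_min n l r)%N ->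
        perfect_state_transfer R (@hamming_union n l r)
        /\ balanced_revival R (@hamming_union n l r)].
Proof.
have phases := revival_phases l_gt0 r1_gt0 r_incr rl_le neq_Xn.
have pst := perfect_transfer_of_le R l_gt0 r1_gt0 r_incr rl_le neq_Xn.
split.
- split=> [[a [b [tau [alpha [beta /phases[x [x_int x_full _]]]]]]]|].
    (* If [lower_min] were smaller, [2 ^+ full_min] would be a multiple of [2 ^+ (lower_min).+1]. *)
    rewrite leqNgt; apply/negP => lt_lf; apply: x_full.
    by rewrite -(subnKC lt_lf) exprD mulrA rpredM // rpredX // rpred_nat.
  by move=> /pst[a [b [tau [alpha [beta [? _]]]]]]; exists a, b, tau, alpha, beta.
- move=> eq_lf; split=> [|a b tau alpha beta]; first by apply: pst; rewrite eq_lf.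
  move=> /phases[x [x_int x_full alphaE]].
  have := phase01_opp l_gt0 r1_gt0 r_incr rl_le neq_Xn (k := 1) x_int.
  (* Under equality, [x_int] is exactly the remaining premise, so every revival time has opposite
     phases and their sum [alpha *+ 2] vanishes. *)
  rewrite mulr1 !expr1 => /(_ x_full); rewrite -eq_lf => /(_ x_int) opp.
  by apply/eqP; move/eqP: alphaE; rewrite opp addNr eq_sym mulrn_eq0.
- move=> lt_fl; split; first exact/pst/ltnW.
  exact: balanced_of_lt.
Qed.
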